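(* For every (finite, simple) graph $G$ without isolated vertices, $\chi'_{sCF}(G)\leq 3\lceil\log_2\chi(G)\rceil$, where $\chi(G)$ is the chromatic number of $G$.
   Context: For a graph $H$ and a vertex $v$, let $E_H(v)$ be the set of edges of $H$ incident to $v$, and for a pair $u,v$ let $E_H[uv]=E_H(u)\cup E_H(v)$. Given a graph $G$ and an edge colouring $c$ (not necessarily proper) of some subgraph $H$ of $G$, an edge $e$ of $G$ is satisfied by $c$ if the multiset $\{c(e'): e'\in E_H[e]\}$ contains a colour occurring exactly once in it. The parameter $\chi'_{sCF}(G)$ is the least number of colours for which there exist a subgraph $H$ of $G$ and an edge colouring of $H$ with that many colours satisfying every edge of $G$. *)

(* Defs.v *)
From HB Require Import structures.
From mathcomp Require Import all_boot.

Set Implicit Arguments.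
Unset Strict Implicit.
Unset Printing Implicit Defensive.

Record sgraph := SGraph {
  vertex :> finType;
  adj : rel vertex;
  adj_sym : symmetric adj;
  adj_irrefl : irreflexive adj }.

Definition no_isolated (G : sgraph) : Prop :=
  forall v : G, exists w : G, adj v w.

Section ChromaticNumber.
Variable G : sgraph.

Definition proper_colouring (k : nat) (c : {ffun G -> 'I_k}) : bool :=
  [forall u : G, forall v : G, adj u v ==> (c u != c v)].

Definition colourable (k : nat) : bool :=
  [exists c : {ffun G -> 'I_k}, proper_colouring c].

Lemma colourable_ex : exists k, colourable k.
Proof.
exists #|G|; apply/existsP; exists [ffun v => enum_rank v].
apply/forallP => u; apply/forallP => v; apply/implyP => uv.
rewrite !ffunE; apply: contraTneq uv => /enum_rank_inj ->.
by rewrite adj_irrefl.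
Qed.

Definition chi : nat := ex_minn colourable_ex.

End ChromaticNumber.

Section ConflictFree.
Variable G : sgraph.

Definition edges : {set {set G}} :=
  [set [set p.1; p.2] | p : G * G & adj p.1 p.2].

Definition is_subgraph (V : {set G}) (F : {set {set G}}) : bool :=
  (F \subset edges) && [forall f in F, f \subset V].

Definition edges_at (F : {set {set G}}) (v : G) : {set {set G}} :=
  [set f in F | v \in f].

Definition edges_at2 (F : {set {set G}}) (u v : G) : {set {set G}} :=
  edges_at F u :|: edges_at F v.

(* A colouring is a function on the edges of the subgraph only, so that an
   edgeless subgraph has a colouring with 0 colours. *)
Definition edge_colouring (F : {set {set G}}) (k : nat) :=
  {ffun {f : {set G} | f \in F} -> 'I_k}.

Definition satisfied (F : {set {set G}}) (k : nat)
    (c : edge_colouring F k) (u v : G) : bool :=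
  [exists a : 'I_k,
     #|[set f : {f : {set G} | f \in F} |
        (val f \in edges_at2 F u v) && (c f == a)]| == 1].

Definition sCF_colourable (k : nat) : bool :=
  [exists V : {set G}, exists F : {set {set G}},
     is_subgraph V F &&
     [exists c : edge_colouring F k,
        [forall u : G, forall v : G, adj u v ==> satisfied c u v]]].

Lemma sCF_colourable_ex : exists k, sCF_colourable k.
Proof.
exists #|{: {f : {set G} | f \in edges}}|.
apply/existsP; exists setT; apply/existsP; exists edges.
rewrite /is_subgraph subxx /=; apply/andP; split.
  by apply/forallP => f; rewrite subsetT implybT.
apply/existsP; exists [ffun f => enum_rank f].
apply/forallP => u; apply/forallP => v; apply/implyP => uv.
have uvE : [set u; v] \in edges by apply/imsetP; exists (u, v); rewrite ?inE.
pose g : {f : {set G} | f \in edges} := Sub [set u; v] uvE.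
apply/existsP; exists (enum_rank g); apply/cards1P; exists g.
apply/setP => f; rewrite !inE ffunE (inj_eq enum_rank_inj).
case: eqP => [->|_]; last by rewrite andbF.
by rewrite andbT uvE !inE eqxx.
Qed.

Definition chi'_sCF : nat := ex_minn sCF_colourable_ex.

End ConflictFree.

(* Main.v *)
Require Import Defs.
From mathcomp Require Import all_boot.

(** Label the vertices by [t = up_log 2 (chi G)] bits so that adjacent vertices
    get distinct labels, and sort the edges according to a bit on which their
    ends differ. This splits [G] into [t] edge-disjoint bipartite graphs, to be
    treated with disjoint palettes.  In a bipartite graph with parts [X], [Y],
    take a minimal subset [Y'] of [Y] dominating the non-isolated vertices of
    [X], let [H] consist of one edge from each such [x] to some [f x] in [Y'],
    and choose a private neighbour [p y] of each [y] in [Y'].  Colour the edges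
    between [p y] and [y] with one colour and the rest of [H] with another.
    An edge [x y] of the bipartite graph with [y] in [Y'] then sees the first
    colour only on the edge between [p y] and [y], while for [y] outside [Y']
    it meets only the edge of [H] between [x] and [f x].  So two colours for
    each bit are enough. *)

(** The hypothesis makes [e] a bipartite graph oriented from one part to the other: no head is a
    tail. Edges of H are indexed by their tail [w], those with [e w (f w)], and coloured by
    [P w]. *)
Lemma bipartite_star_forest (T : finType) (e : rel T) :
    (forall x y z, e x y -> ~~ e y z) ->
  exists (f : T -> T) (P : pred T),
    (forall x y, e x y -> e x (f x)) /\
    (forall x y, e x y -> exists w, [/\ e w (f w),
       (x \in [set w; f w]) || (y \in [set w; f w]) &
       forall w', e w' (f w') ->
         (x \in [set w'; f w']) || (y \in [set w'; f w']) ->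
         P w' = P w -> w' = w]).
Proof.
move=> e2; pose dom x := [exists y, e x y].
have domI x y : e x y -> dom x by move=> xy; apply/existsP; exists y.
pose Q (A : {set T}) := [forall (x | dom x), exists y in A, e x y].
have [|A /minsetP[/forall_inP QA minA]] := @ex_minset _ Q.
  exists setT; apply/forall_inP => x /existsP[y xy].
  by apply/exists_inP; exists y.
pose f x := odflt x [pick y in A | e x y].
have fP x : dom x -> (f x \in A) /\ e x (f x).
  move=> /QA/exists_inP[y yA xy]; rewrite /f.
  by case: pickP => [z /andP[]|/(_ y)] //=; rewrite yA xy.
pose private y x := dom x && [forall (z | z \in A), e x z ==> (z == y)].
(* By minimality [A :\ y] leaves some [x] undominated, so [y] is the only neighbour of [x] in
   [A]. *)
have private_ex y : y \in A -> exists x, private y x.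
  move=> yA; have : ~~ Q (A :\ y).
    apply/negP => /minA /(_ (subD1set _ _)) E.
    by move: yA; rewrite -E !inE eqxx.
  case/forall_inPn => x dx /exists_inPn nx.
  exists x; apply/andP; split=> //; apply/forall_inP => z zA.
  by apply/implyP => xz; apply: contraTT xz => zy; apply: nx; rewrite !inE zy.
have privateP y x z : private y x -> z \in A -> e x z -> z = y.
  by case/andP=> _ /forall_inP H /H/implyP Hz /Hz/eqP.
pose p y := odflt y [pick x | private y x].
have pP y : y \in A -> private y (p y).
  move=> /private_ex[x xy]; rewrite /p.
  by case: pickP => //= /(_ x); rewrite xy.
have fp y : y \in A -> f (p y) = y.
  move=> /pP pr; have [dp _] := andP pr.
  by have [fA fe] := fP _ dp; apply: privateP pr fA fe.
exists f, [pred x | p (f x) == x]; split=> [x y /domI/fP[]//|x y xy].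
(* As [x] is a tail and [y] a head, neither [w = y] nor [f w = x] can occur. *)
have hit w : e w (f w) -> (x \in [set w; f w]) || (y \in [set w; f w]) ->
    w = x \/ f w = y.
  move=> we; rewrite !inE => /orP[]/orP[]/eqP E; [by left| | |by right].
    by rewrite -E in we; have := e2 _ _ y we; rewrite xy.
  by have := e2 _ _ (f w) xy; rewrite E we.
have [yA|yA] := boolP (y \in A).
  have [dp _] := andP (pP _ yA); have [_ ep] := fP _ dp.
  exists (p y); split=> //; first by rewrite !inE fp ?eqxx ?orbT.
  move=> w we /(hit _ we) hw /=; rewrite fp // eqxx => /eqP pw.
  case: hw => [wx|fw]; last by rewrite -fw.
  (* Here [x] is private to [f x], which forces [y = f x]. *)
  have [fA _] := fP _ (domI _ _ we).
  have pr := pP _ fA; rewrite pw wx in pr.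
  by rewrite (privateP _ _ _ pr yA xy) -wx.
have [_ ex] := fP _ (domI _ _ xy).
exists x; split=> //; first by rewrite !inE eqxx.
move=> w we /(hit _ we)[//|fw]; case/negP: yA; rewrite -fw.
by have [] := fP _ (domI _ _ we).
Qed.

(** Injectivity of [E] on [D] lets colours and uniqueness be checked on indices instead of edges. *)
Lemma sCF_colourable_index (G : sgraph) (C I : finType) (D : {set I})
    (E : I -> {set G}) (col : I -> C) :
    {in D, forall d, E d \in edges G} -> {in D &, injective E} ->
    (forall u v, adj u v -> exists2 d, d \in D &
       ((u \in E d) || (v \in E d)) /\
       {in D, forall d', (u \in E d') || (v \in E d') ->
                         col d' = col d -> d' = d}) ->
  sCF_colourable G #|C|.
Proof.
move=> Eedge Einj sat; pose F := E @: D.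
have FP (g : {A : {set G} | A \in F}) : exists d, (d \in D) && (E d == val g).
  by case: g => A /= /imsetP[d dD ->]; exists d; rewrite dD eqxx.
pose ix g := xchoose (FP g).
have ixP g : ix g \in D /\ E (ix g) = val g.
  by have /andP[? /eqP] := xchooseP (FP g).
apply/existsP; exists setT; apply/existsP; exists F; apply/andP; split.
  apply/andP; split; last by apply/forallP=> g; rewrite subsetT implybT.
  by apply/subsetP=> _ /imsetP[d dD ->]; apply: Eedge.
apply/existsP; exists [ffun g => enum_rank (col (ix g))].
apply/forallP => u; apply/forallP => v; apply/implyP => /sat[d dD [md dU]].
have EF : E d \in F by apply: imset_f.
pose g : {A : {set G} | A \in F} := Sub (E d) EF.
have ixg : ix g = d by have [? ?] := ixP g; apply: Einj.
apply/existsP; exists (enum_rank (col d)); apply/cards1P; exists g.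
apply/setP => h; rewrite !inE ffunE (inj_eq enum_rank_inj).
apply/andP/eqP => [[mh /eqP ch]|->]; last first.
  by rewrite ixg eqxx /= EF.
have [hD hE] := ixP h; apply: val_inj; rewrite -hE /=; congr E.
by apply: dU ch => //; rewrite hE; case: (val h \in F) mh.
Qed.

Lemma chi_bit_labelling (G : sgraph) :
  exists b : G -> {ffun 'I_(up_log 2 (chi G)) -> bool},
    forall u v, adj u v -> b u != b v.
Proof.
rewrite /chi; case: ex_minnP => k /existsP[c /forallP cP] _.
have le : k <= #|{: {ffun 'I_(up_log 2 k) -> bool}}|.
  by rewrite card_ffun card_bool card_ord up_logP.
exists (fun u => enum_val (widen_ord le (c u))) => u v uv.
have /forallP/(_ v)/implyP/(_ uv) := cP u; apply: contraNneq => /enum_val_inj E.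
by apply/eqP/val_inj; have := congr1 val E.
Qed.

Lemma sCF_colourable_double_log (G : sgraph) :
  sCF_colourable G (up_log 2 (chi G) * 2).
Proof.
have [b bP] := chi_bit_labelling G; move: (up_log _ _) b bP => t b bP.
pose lev u v := [pick i | b u i != b v i].
have levC u v : lev u v = lev v u by apply: eq_pick => i; rewrite eq_sym.
have levP u v : adj u v -> exists2 i, lev u v = Some i & b u i != b v i.
  move=> /bP uv; rewrite /lev; case: pickP => [i|E]; first by exists i.
  by case/eqP: uv; apply/ffunP => i; apply/eqP/negPn; rewrite E.
(* Each edge belongs to its picked bit alone, and runs from the end where this bit is true to the
   end where it is false. *)
pose e i u v := [&& adj u v, lev u v == Some i, b u i & ~~ b v i].
have e2 i x y z : e i x y -> ~~ e i y z.
  by rewrite /e => /and4P[_ _ _ /negPf->]; rewrite !andbF.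
have [f fP] := fin_all_exists (fun i => bipartite_star_forest _ _ (e2 i)).
have {fP}[P fP] := fin_all_exists fP.
rewrite -card_bool -[X in X * _](card_ord t) -card_prod.
apply: (@sCF_colourable_index G _ _ [set d : 'I_t * G | e d.1 d.2 (f d.1 d.2)]
  (fun d => [set d.2; f d.1 d.2]) (fun d => (d.1, P d.1 d.2))).
- move=> [i x]; rewrite inE /= => /and4P[xf _ _ _].
  by apply/imsetP; exists (x, f i x); rewrite ?inE.
(* Equal edges have equal [lev], and the bit at each end rules out the swapped orientation. *)
- move=> [i x] [j y]; rewrite !inE /=.
  move=> /and4P[_ /eqP li bx bfx] /and4P[_ /eqP lj by_ bfy] E.
  have := set21 x (f i x); rewrite E => /set2P[xy|xf].
    have := set22 x (f i x); rewrite E => /set2P[fx|fx].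
      by move: bfx; rewrite fx -xy bx.
    by congr pair => //; apply: Some_inj; rewrite -li -lj fx xy.
  have := set21 y (f j y); rewrite -E => /set2P[yx|yf].
    by move: bfy; rewrite -xf -yx by_.
  have ij : i = j by apply: Some_inj; rewrite -li -lj -xf -yf levC.
  by move: bfy; rewrite -xf -ij bx.
- have sat i u v : e i u v -> exists2 d, d \in
      [set d : 'I_t * G | e d.1 d.2 (f d.1 d.2)] &
      ((u \in [set d.2; f d.1 d.2]) || (v \in [set d.2; f d.1 d.2])) /\
      {in [set d : 'I_t * G | e d.1 d.2 (f d.1 d.2)], forall d',
        (u \in [set d'.2; f d'.1 d'.2]) || (v \in [set d'.2; f d'.1 d'.2]) ->
        (d'.1, P d'.1 d'.2) = (d.1, P d.1 d.2) -> d' = d}.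
    move=> uv; have [_ /(_ _ _ uv)[w [we mw wU]]] := fP i.
    exists (i, w); first by rewrite inE.
    split=> [|[j x]]; [exact: mw | rewrite inE /=].
    by move=> xe mx [ji]; subst j => /wU ->.
  move=> u v uv; have [i li bi] := levP _ _ uv.
  have [bu|bu] := boolP (b u i).
    by apply: (sat i); rewrite /e uv li eqxx bu; move: bi; rewrite bu; case: (b v i).
  have [|d dD [md dU]] := sat i v u.
    rewrite /e adj_sym uv levC li eqxx bu andbT.
    by move: bi; rewrite (negPf bu); case: (b v i).
  by exists d => //; split; [rewrite orbC | move=> d' d'D; rewrite orbC; apply: dU].
Qed.

Theorem theorem2 (G : sgraph) (hG : no_isolated G) :
  chi'_sCF G <= 3 * up_log 2 (chi G).
Proof.
rewrite /chi'_sCF; case: ex_minnP => k _ /(_ _ (sCF_colourable_double_log G)).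
by move=> /leq_trans-> //; rewrite mulnC leq_mul2r orbT.
Qed.
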